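(* Let $v(z)=h(z)+\overline{g(z)}=\sum_{k=0}^{\infty}c_{k}z^{k}+\sum_{k=1}^{\infty}c_{-k}\bar{z}^{k}$ be a harmonic mapping defined on the unit disk $\mathbb{D}$, where $h(z)=\sum_{k=0}^\infty c_k z^k$ and $g(z)=\sum_{k=1}^\infty \overline{c_{-k}}\,z^k$. If $\frac{\alpha}{2}=p-1$ is a nonnegative integer, then the corresponding real kernel $\alpha$-harmonic mapping $u$ of $v$ can be represented by $$u(z)=\sum_{n=0}^{p-1}|z|^{2n}\frac{(1-p)_{n}}{n!}\left(I_{n}(z)+\overline{J_{n}(z)}\right),\qquad z\in\mathbb{D},$$ where $I_n$ and $J_n$ satisfy the recurrence formulas $$I_{n}(z)=I_{n-1}(z)-p\,\frac{\int_{0}^{z}\zeta^{n-1}I_{n-1}(\zeta)\,d\zeta}{z^{n}},\qquad J_{n}(z)=J_{n-1}(z)-p\,\frac{\int_{0}^{z}\zeta^{n-1}J_{n-1}(\zeta)\,d\zeta}{z^{n}},\qquad n=1,2,\dots,p-1,$$ with $I_{0}=h$ and $J_{0}=g$.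
   Context: $\mathbb{D}$ is the open unit disk in $\mathbb{C}$. $(a)_0=1$ and $(a)_n=a(a+1)\cdots(a+n-1)$ for $n\ge 1$ are the Pochhammer symbols, and $F(a,b;c;x)=\sum_{n=0}^{\infty}\frac{(a)_n(b)_n}{(c)_n}\frac{x^n}{n!}$ ($|x|<1$) is the Gauss hypergeometric function. For $\alpha>-1$ and a harmonic mapping $v(z)=\sum_{k=0}^{\infty}c_{k}z^{k}+\sum_{k=1}^{\infty}c_{-k}\bar{z}^{k}$ on $\mathbb{D}$ (with $\limsup_{|k|\to\infty}|c_k|^{1/|k|}\le 1$), the corresponding real kernel $\alpha$-harmonic mapping of $v$ is $$u(z)=\sum_{k=0}^{\infty}c_{k}F\left(-\tfrac{\alpha}{2},k-\tfrac{\alpha}{2};k+1;|z|^{2}\right)z^{k}+\sum_{k=1}^{\infty}c_{-k}F\left(-\tfrac{\alpha}{2},k-\tfrac{\alpha}{2};k+1;|z|^{2}\right)\bar{z}^{k},\quad z\in\mathbb{D}.$$ The quotients in the recurrence formulas are understood at $z=0$ via their removable singularity there. *)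

(* Defs.v *)
From Stdlib Require Import Reals ZArith.
From Coquelicot Require Import Coquelicot.
Open Scope R_scope.

Definition in_disk (z : C) : Prop := Cmod z < 1.

Fixpoint pochhammer (a : R) (n : nat) : R :=
  match n with
  | O => 1
  | S m => pochhammer a m * (a + INR m)
  end.

Definition hyp2F1 (a b c x : R) : R :=
  PSeries (fun n => pochhammer a n * pochhammer b n / pochhammer c n / INR (fact n)) x.

(* [ex_diff_n _ 2] includes continuity of the second-order partial derivatives,
   so holding at every point of the disk it says that f is of class C^2 there. *)
Definition harmonic_on_disk (f : R -> R -> R) : Prop :=
  forall x y : R, in_disk (x, y) ->
    ex_diff_n f 2 x y /\
    partial_derive 2 0 f x y + partial_derive 0 2 f x y = 0.

Definition harmonic_mapping (v : C -> C) : Prop :=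
  harmonic_on_disk (fun x y => Re (v (x, y))) /\
  harmonic_on_disk (fun x y => Im (v (x, y))).

(* Sum of a complex series; like [Series], it is total and meaningful for
   convergent series. *)
Definition CSeries (a : nat -> C) : C :=
  (Series (fun k => Re (a k)), Series (fun k => Im (a k))).

(* The second series is the one over k >= 1, written with k = S j. *)
Definition real_kernel_harmonic (alpha : R) (c : Z -> C) (z : C) : C :=
  (CSeries (fun k : nat =>
     c (Z.of_nat k)
     * RtoC (hyp2F1 (- (alpha / 2)) (INR k - alpha / 2) (INR k + 1) (Cmod z ^ 2)%R)
     * z ^ k)
   + CSeries (fun j : nat =>
     let k := S j in
     c (- Z.of_nat k)%Z
     * RtoC (hyp2F1 (- (alpha / 2)) (INR k - alpha / 2) (INR k + 1) (Cmod z ^ 2)%R)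
     * Cconj z ^ k))%C.

(* The integral from 0 to z along the segment [t |-> t * z]; the integrands
   used are holomorphic on the disk, so the choice of path is immaterial. *)
Definition integral_from_0 (f : C -> C) (z : C) : C :=
  RInt (V := C_R_CompleteNormedModule) (fun t : R => (f (RtoC t * z) * z)%C) 0 1.

(* q is the value at z of [fun w => F w / w ^ n], the singularity at 0 being
   removed; in Coquelicot [F 0 / 0] carries no information. *)
Definition is_quotient_value (F : C -> C) (n : nat) (z q : C) : Prop :=
  (z <> RtoC 0 -> q = (F z / z ^ n)%C) /\
  (z = RtoC 0 ->
   filterlim (fun w : C => (F w / w ^ n)%C) (locally' (RtoC 0)) (locally q)).

Definition recurrence (p : nat) (I : nat -> C -> C) : Prop :=
  forall n : nat, (1 <= n <= p - 1)%nat ->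
  forall z : C, in_disk z ->
  exists q : C,
    is_quotient_value
      (integral_from_0 (fun zeta => (zeta ^ (n - 1) * I (n - 1)%nat zeta)%C)) n z q /\
    I n z = (I (n - 1)%nat z - RtoC (INR p) * q)%C.

(* Main.v *)
(* If a power series [sum a_k z^k] represents [I_{n-1}], then integrating
   [zeta^(n-1) I_{n-1}] term by term and dividing by [z^n] multiplies [a_k] by
   [1/(k+n)], so the recurrence multiplies it by [(k+n-p)/(k+n)].  Hence [I_n] has
   coefficients [(k+1-p)_n/(k+1)_n a_k].  As [(1-p)_n = 0] for [n >= p], the
   hypergeometric factor of the kernel is a polynomial of degree [p-1] in [|z|^2],
   and exchanging this finite sum with the series over [k] gives the formula. *)
Require Import Defs.
From Stdlib Require Import Reals ZArith Lra Lia.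
From Coquelicot Require Import Coquelicot.
Open Scope R_scope.

(* Coquelicot's structure projections hide the carrier [C] from [ring]. *)
Ltac eq_in_C := match goal with |- ?l = ?r => change (@eq C l r) end.

(** * Convergence in [C] through real and imaginary parts *)

Lemma Re_sum_n (a : nat -> C) (n : nat) :
  Re (sum_n a n) = sum_n (fun k => Re (a k)) n.
Proof.
induction n as [|n IH].
- now rewrite !sum_O.
- now rewrite !sum_Sn, <- IH.
Qed.

Lemma Im_sum_n (a : nat -> C) (n : nat) :
  Im (sum_n a n) = sum_n (fun k => Im (a k)) n.
Proof.
induction n as [|n IH].
- now rewrite !sum_O.
- now rewrite !sum_Sn, <- IH.
Qed.

Lemma filterlim_C_components {T} (F : (T -> Prop) -> Prop) {FF : Filter F}
  (f : T -> C) (l : C) :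
  filterlim f F (locally l) <->
  filterlim (fun x => Re (f x)) F (locally (Re l)) /\
  filterlim (fun x => Im (f x)) F (locally (Im l)).
Proof.
rewrite 3!filterlim_locally. split.
- intros H; split; intros eps; generalize (H eps); apply filter_imp;
    now intros x [? ?].
- intros [Hr Hi] eps. generalize (filter_and _ _ (Hr eps) (Hi eps)).
  apply filter_imp. now intros x [? ?].
Qed.

Lemma is_series_C_components (a : nat -> C) (l : C) :
  is_series a l <->
  is_series (fun k => Re (a k)) (Re l) /\ is_series (fun k => Im (a k)) (Im l).
Proof.
unfold is_series.
etransitivity. { apply (filterlim_C_components eventually (sum_n a) l). }
split; intros [Hr Hi]; split.
- eapply filterlim_ext; [|exact Hr]. intros n; apply Re_sum_n.
- eapply filterlim_ext; [|exact Hi]. intros n; apply Im_sum_n.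
- eapply filterlim_ext; [|exact Hr]. intros n; symmetry; apply Re_sum_n.
- eapply filterlim_ext; [|exact Hi]. intros n; symmetry; apply Im_sum_n.
Qed.

Lemma is_series_CSeries (a : nat -> C) (l : C) : is_series a l -> CSeries a = l.
Proof.
intros H. apply is_series_C_components in H as [Hr Hi].
unfold CSeries. rewrite (is_series_unique _ _ Hr), (is_series_unique _ _ Hi).
now destruct l.
Qed.

Lemma is_series_conj (a : nat -> C) (l : C) :
  is_series a l -> is_series (fun k => Cconj (a k)) (Cconj l).
Proof.
rewrite !is_series_C_components. intros [Hr Hi]. split; simpl; [exact Hr|].
exact (is_series_opp _ _ Hi).
Qed.

(** * Termwise integration of power series along a ray *)

(** Beyond the radius of convergence the terms cannot tend to 0. The strict bound leaves room to
    integrate up to the endpoint 1. *)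
Lemma CV_radius_gt_1 (a : nat -> R) (r : R) :
  1 < r -> ex_series (fun k => a k * r ^ k) -> Rbar_lt 1 (CV_radius a).
Proof.
intros Hr H.
apply Rbar_lt_le_trans with (Finite r); [exact Hr|].
apply Rbar_not_lt_le. intros Hlt.
apply (CV_disk_outside a r).
- rewrite Rabs_pos_eq; [exact Hlt|lra].
- now apply ex_series_lim_0.
Qed.

(** Multiplication by [t ^ m] shifts the coefficients by [m], and integration up to 1 is termwise
    because 1 lies strictly inside the interval of convergence. *)
Lemma is_RInt_monomial_PSeries (a : nat -> R) (m : nat) (r : R) :
  1 < r -> ex_series (fun k => a k * r ^ k) ->
  is_RInt (fun t => t ^ m * PSeries a t) 0 1
    (Series (fun k => a k / (INR k + INR (S m)))).
Proof.
intros Hr Ha.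
apply is_RInt_ext with (PSeries (PS_incr_n a m)).
{ intros t _. apply PSeries_incr_n. }
replace (Series _) with (PSeries (PS_Int (PS_incr_n a m)) 1).
- apply is_RInt_PSeries. rewrite Rabs_R1. apply CV_radius_gt_1 with r; [exact Hr|].
  apply ex_pseries_R, ex_pseries_incr_n, ex_pseries_R, Ha.
- rewrite <- PSeries_1.
  (* The factor [1 ^ S m] makes the right-hand side a series shifted by [S m], comparable with
     [PS_Int] coefficient by coefficient. *)
  transitivity (1 ^ S m * PSeries (fun k => a k / (INR k + INR (S m))) 1);
    [|rewrite pow1; ring].
  rewrite <- PSeries_incr_n.
  apply PSeries_ext. intros k. rewrite PS_incr_n_simplify.
  destruct k as [|k]; simpl PS_Int; destruct le_lt_dec as [Hk|Hk]; try lia; try reflexivity.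
  + rewrite PS_incr_n_simplify. destruct le_lt_dec as [Hk'|Hk']; [|lia].
    change (S k - S m)%nat with (k - m)%nat.
    rewrite <- plus_INR. replace (k - m + S m)%nat with (S k) by lia. reflexivity.
  + rewrite PS_incr_n_simplify. destruct le_lt_dec as [Hk'|Hk']; [lia|].
    apply Rmult_0_l.
Qed.

(** The weights are at most 1, so absolute convergence at 1 dominates. A value of [Series] alone
    says nothing about convergence. *)
Lemma ex_series_div_index (a : nat -> R) (m : nat) (r : R) :
  1 < r -> ex_series (fun k => a k * r ^ k) ->
  ex_series (fun k => a k / (INR k + INR (S m))).
Proof.
intros Hr Ha.
apply (ex_series_le (V := R_CompleteNormedModule)) with (fun k => Rabs (a k * 1 ^ k)).
- intros k. change norm with Rabs. rewrite pow1, Rmult_1_r.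
  unfold Rdiv. rewrite Rabs_mult.
  rewrite <- (Rmult_1_r (Rabs (a k))) at 2.
  apply Rmult_le_compat_l; [apply Rabs_pos|].
  pose proof (pos_INR k). pose proof (pos_INR m). rewrite S_INR.
  rewrite Rabs_pos_eq; [|left; apply Rinv_0_lt_compat; lra].
  rewrite <- Rinv_1. apply Rinv_le_contravar; lra.
- apply CV_disk_inside. rewrite Rabs_R1. now apply CV_radius_gt_1 with r.
Qed.

Lemma in_disk_scal (z : C) :
  in_disk z -> exists r, 1 < r /\ forall t, 0 <= t <= r -> in_disk (RtoC t * z)%C.
Proof.
unfold in_disk. intros Hz. pose proof (Cmod_ge_0 z).
(* With [r = 2 / (1 + |z|)] one has [r > 1] and [r |z| = 2 - r < 1]. *)
assert (Hq : 2 / (1 + Cmod z) * (1 + Cmod z) = 2) by (field; lra).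
exists (2 / (1 + Cmod z)). split; [nra|].
intros t Ht. rewrite Cmod_mult, Cmod_R, Rabs_pos_eq by lra. nra.
Qed.

Lemma RtoC_mul_components (x : R) (w : C) :
  Re (RtoC x * w) = x * Re w /\ Im (RtoC x * w) = x * Im w.
Proof. destruct w; simpl; split; ring. Qed.

(* Restricting a power series to the ray through [z] turns it into two real
   power series with radius of convergence greater than 1. *)
Lemma power_series_ray (a : nat -> C) (f : C -> C) (z : C) :
  (forall w, in_disk w -> is_series (fun k => (a k * w ^ k)%C) (f w)) ->
  in_disk z ->
  exists r, 1 < r /\
    ex_series (fun k => Re (a k * z ^ k) * r ^ k) /\
    ex_series (fun k => Im (a k * z ^ k) * r ^ k) /\
    forall t, 0 <= t <= r ->
      in_disk (RtoC t * z)%C /\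
      f (RtoC t * z)%C = (PSeries (fun k => Re (a k * z ^ k)) t,
                          PSeries (fun k => Im (a k * z ^ k)) t).
Proof.
intros Hf Hz. destruct (in_disk_scal z Hz) as [r [Hr Hdisk]].
assert (Hs : forall t, 0 <= t <= r ->
  is_series (fun k => Re (a k * z ^ k) * t ^ k) (Re (f (RtoC t * z)%C)) /\
  is_series (fun k => Im (a k * z ^ k) * t ^ k) (Im (f (RtoC t * z)%C))).
{ intros t Ht. destruct (proj1 (is_series_C_components _ _) (Hf _ (Hdisk t Ht))) as [H1 H2].
  split; [eapply is_series_ext; [|exact H1]|eapply is_series_ext; [|exact H2]];
  intros k; cbv beta;
  rewrite Cpow_mult_l, <- RtoC_pow;
  replace (a k * (RtoC (t ^ k) * z ^ k))%C with (RtoC (t ^ k) * (a k * z ^ k))%C by ring;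
  destruct (RtoC_mul_components (t ^ k) (a k * z ^ k)%C) as [E1 E2];
  rewrite ?E1, ?E2; apply Rmult_comm. }
exists r. repeat split.
- exact Hr.
- eexists; apply (Hs r); lra.
- eexists; apply (Hs r); lra.
- now apply Hdisk.
- destruct (Hs t H) as [H1 H2].
  unfold PSeries. rewrite (is_series_unique _ _ H1), (is_series_unique _ _ H2).
  now destruct (f _).
Qed.

(** On the segment the integrand is [z^(m+1) * t^m * f(t z)]. The power of [z] comes out, and the
    rest is integrated as two real power series in [t]. *)
Lemma integral_monomial_power_series (a : nat -> C) (f : C -> C) (m : nat) (z : C) :
  (forall w, in_disk w -> is_series (fun k => (a k * w ^ k)%C) (f w)) ->
  in_disk z ->
  exists s : C,
    is_series (fun k => (RtoC (/ (INR k + INR (S m))) * a k * z ^ k)%C) s /\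
    integral_from_0 (fun w => (w ^ m * f w)%C) z = (z ^ S m * s)%C.
Proof.
intros Hf Hz.
destruct (power_series_ray a f z Hf Hz) as [r [Hr [Hre [Him Hray]]]].
pose proof (is_RInt_monomial_PSeries _ m r Hr Hre) as Ire.
pose proof (is_RInt_monomial_PSeries _ m r Hr Him) as Iim.
destruct (ex_series_div_index _ m r Hr Hre) as [x Hx].
destruct (ex_series_div_index _ m r Hr Him) as [y Hy].
cbv beta in Ire, Iim, Hx, Hy.
rewrite (is_series_unique _ _ Hx) in Ire. rewrite (is_series_unique _ _ Hy) in Iim.
exists (x, y). split.
- apply is_series_C_components. split.
  + eapply is_series_ext; [|exact Hx]. intros k. cbv beta.
    rewrite <- Cmult_assoc, (proj1 (RtoC_mul_components _ _)). apply Rmult_comm.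
  + eapply is_series_ext; [|exact Hy]. intros k. cbv beta.
    rewrite <- Cmult_assoc, (proj2 (RtoC_mul_components _ _)). apply Rmult_comm.
- apply (is_RInt_unique (V := C_R_CompleteNormedModule)).
  (* Here [p] and [q] are the real and imaginary parts of [z^(m+1)]; expanding the product reduces
     the claim to real integrals. *)
  destruct (z ^ S m)%C as [p q] eqn:Ezm.
  set (P := PSeries (fun k => Re (a k * z ^ k))) in *.
  set (Q := PSeries (fun k => Im (a k * z ^ k))) in *.
  apply (is_RInt_ext (V := C_R_NormedModule))
    with (fun t => (p * (t ^ m * P t) - q * (t ^ m * Q t),
                    p * (t ^ m * Q t) + q * (t ^ m * P t))).
  + intros t Ht. rewrite Rmin_left, Rmax_right in Ht by lra.
    rewrite (proj2 (Hray t ltac:(lra))). fold P Q.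
    transitivity ((RtoC (t ^ m) * (P t, Q t)) * z ^ S m)%C.
    * rewrite Ezm. apply injective_projections; simpl; ring.
    * rewrite Cpow_mult_l, <- RtoC_pow, Cpow_S.
      eq_in_C. ring.
  + apply (is_RInt_fct_extend_pair (U := R_NormedModule) (V := R_NormedModule)).
    * apply (is_RInt_minus (V := R_NormedModule)); now apply (is_RInt_scal (V := R_NormedModule)).
    * apply (is_RInt_plus (V := R_NormedModule)); now apply (is_RInt_scal (V := R_NormedModule)).
Qed.

(** * The quotient and its removable singularity at 0 *)

(** Turns a limit over a punctured neighbourhood into a one-sided real limit; [t > 0] keeps the ray
    off the origin. *)
Lemma filterlim_ray_0 (z : C) :
  z <> RtoC 0 -> filterlim (fun t => (RtoC t * z)%C) (at_right 0) (locally' (RtoC 0)).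
Proof.
intros Hz P [eps HP].
assert (Hm : 0 < Cmod z) by now apply Cmod_gt_0.
assert (Hd : 0 < eps / Cmod z) by (apply Rdiv_lt_0_compat; [apply cond_pos|exact Hm]).
exists (mkposreal _ Hd). intros t Ht Ht0. simpl in Ht.
assert (Habs : Rabs t < eps / Cmod z).
{ replace t with (t - 0) by ring. exact Ht. }
apply HP.
- apply C_NormedModule_mixin_compat1.
  replace (minus (RtoC t * z)%C (RtoC 0)) with (RtoC t * z)%C
    by (change minus with Cminus; ring).
  rewrite Cmod_mult, Cmod_R.
  replace (pos eps) with (eps / Cmod z * Cmod z) by (field; lra).
  now apply Rmult_lt_compat_r.
- apply Cmult_neq_0; [|exact Hz].
  intros E. apply (f_equal fst) in E. simpl in E. lra.
Qed.

(** Away from 0 the power cancels. At 0, both [q] and [G 0] are limits of [G] along one ray, and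
    limits are unique. *)
Lemma quotient_value_unique (F G : C -> C) (b : nat -> C) (n : nat) (z q : C) :
  (forall w, in_disk w -> is_series (fun k => (b k * w ^ k)%C) (G w)) ->
  (forall w, in_disk w -> F w = (w ^ n * G w)%C) ->
  in_disk z -> is_quotient_value F n z q -> q = G z.
Proof.
intros HG HF Hz [Hq Hq0].
assert (Hdiv : forall w, in_disk w -> w <> RtoC 0 -> (F w / w ^ n)%C = G w).
{ intros w Hw Hw0. rewrite HF by exact Hw. field. now apply Cpow_nz. }
destruct (Ceq_dec z (RtoC 0)) as [->|Hz0]; [|rewrite (Hq Hz0); now apply Hdiv].
(* The point 1/2 only fixes a ray; any nonzero point of the disk would serve. *)
assert (Hhalf : in_disk (RtoC (1 / 2))).
{ unfold in_disk. rewrite Cmod_R, Rabs_pos_eq; lra. }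
destruct (power_series_ray b G _ HG Hhalf) as [r [Hr [Hre [Him Hray]]]].
assert (Hne : RtoC (1 / 2) <> RtoC 0).
{ intros E. apply (f_equal fst) in E. simpl in E. lra. }
assert (Hpos : at_right 0 (fun t => 0 < t < 1)).
{ exists (mkposreal 1 Rlt_0_1). intros t Ht Ht0. split; [exact Ht0|].
  apply Rabs_def2 in Ht. unfold minus, plus, opp in Ht; simpl in Ht. lra. }
apply (filterlim_locally_unique (K := C_AbsRing) (V := C_NormedModule)
  (F := at_right 0) (fun t => G (RtoC t * RtoC (1 / 2))%C)).
- eapply filterlim_ext_loc; [|eapply filterlim_comp;
    [apply (filterlim_ray_0 _ Hne)|apply (Hq0 eq_refl)]].
  generalize Hpos. apply filter_imp. intros t Ht. apply Hdiv.
  + apply Hray; lra.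
  + apply Cmult_neq_0; [|exact Hne].
    intros E'. apply (f_equal fst) in E'. simpl in E'. lra.
- set (P := PSeries (fun k => Re (b k * RtoC (1 / 2) ^ k))) in *.
  set (Q := PSeries (fun k => Im (b k * RtoC (1 / 2) ^ k))) in *.
  (* Continuity of [G] along the ray comes from its real and imaginary parts, which are power series
     in [t]. *)
  assert (Hcont : forall c, ex_series (fun k => c k * r ^ k) ->
    filterlim (PSeries c) (at_right 0) (locally (PSeries c 0))).
  { intros c Hc. apply (filterlim_filter_le_1 (F := locally 0)).
    - apply filter_le_within.
    - apply continuity_pt_filterlim, PSeries_continuity. rewrite Rabs_R0.
      eapply Rbar_lt_trans; [|now apply CV_radius_gt_1 with r]. exact Rlt_0_1. }
  replace (G (RtoC 0)) with (P 0, Q 0).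
  + apply filterlim_ext_loc with (fun t => (P t, Q t)).
    * generalize Hpos. apply filter_imp. intros t Ht. symmetry. apply Hray. lra.
    * apply (filterlim_C_components (at_right 0)). split; now apply Hcont.
  + rewrite <- (Cmult_0_l (RtoC (1 / 2))). symmetry. apply Hray. lra.
Qed.

(** * The terminating hypergeometric series *)

(** The factor of index [m] is [- m + m = 0] and stays in every later product. *)
Lemma pochhammer_neg_nat (m n : nat) : (m < n)%nat -> pochhammer (- INR m) n = 0.
Proof.
induction n as [|n IH]; [lia|]. intros Hmn. simpl.
destruct (Nat.eq_dec n m) as [->|]; [ring|]. rewrite IH by lia. ring.
Qed.

Lemma pochhammer_pos (a : R) (n : nat) : 0 < a -> 0 < pochhammer a n.
Proof.
intros Ha. induction n as [|n IH]; simpl; [lra|].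
pose proof (pos_INR n). apply Rmult_lt_0_compat; lra.
Qed.

Lemma hyp2F1_neg_nat (m : nat) (b c x : R) :
  hyp2F1 (- INR m) b c x =
  sum_n (fun n => pochhammer (- INR m) n * pochhammer b n / pochhammer c n
                  / INR (fact n) * x ^ n) m.
Proof.
unfold hyp2F1, PSeries. apply is_series_unique.
(* Past index [m] the terms vanish, so the partial sums shifted by [m] are constant. *)
refine (proj2 (is_lim_seq_incr_n (sum_n _) m (Finite _)) _).
apply is_lim_seq_ext with (fun _ => sum_n
  (fun n => pochhammer (- INR m) n * pochhammer b n / pochhammer c n
            / INR (fact n) * x ^ n) m); [|apply is_lim_seq_const].
intros k. induction k as [|k IH]; [reflexivity|].
rewrite Nat.add_succ_l, sum_Sn, <- IH, (pochhammer_neg_nat m (S (k + m))) by lia.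
unfold Rdiv. rewrite !Rmult_0_l. symmetry. apply Rplus_0_r.
Qed.

(** * Expansions of the iterates and of one half of the kernel *)

(** Matches the second kernel series, which starts at [k = 1] and is reindexed by [k = S j]. *)
Lemma is_series_drop_zero (a : nat -> C) (l : C) :
  a 0%nat = RtoC 0 -> is_series a l -> is_series (fun k => a (S k)) l.
Proof.
intros H0 H. apply (is_series_incr_1 (V := C_NormedModule)).
rewrite H0. change (is_series a (l + RtoC 0)%C). now rewrite Cplus_0_r.
Qed.

Lemma is_series_sum_n (a : nat -> nat -> C) (s : nat -> C) (m : nat) :
  (forall n, (n <= m)%nat -> is_series (a n) (s n)) ->
  is_series (fun k => sum_n (fun n => a n k) m) (sum_n s m).
Proof.
induction m as [|m IH]; intros H.
- rewrite sum_O. eapply is_series_ext; [|now apply H].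
  intros k. now rewrite sum_O.
- rewrite sum_Sn.
  eapply is_series_ext; [|apply (is_series_plus (V := C_NormedModule));
    [apply IH; intros; apply H; lia|now apply H]].
  intros k. now rewrite sum_Sn.
Qed.

(** The induction carries the expansion over the whole disk, since the next integral uses it along
    an entire ray. *)
Lemma recurrence_power_series (p : nat) (I : nat -> C -> C) (a : nat -> C) :
  recurrence p I ->
  (forall z, in_disk z -> is_series (fun k => (a k * z ^ k)%C) (I 0%nat z)) ->
  forall n, (n <= p - 1)%nat -> forall z, in_disk z ->
  is_series (fun k => (RtoC (pochhammer (INR k + 1 - INR p) n / pochhammer (INR k + 1) n)
                       * a k * z ^ k)%C) (I n z).
Proof.
intros HI H0 n. induction n as [|m IH]; intros Hn z Hz.
- eapply is_series_ext; [|now apply H0]. intros k. simpl.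
  rewrite Rdiv_1_r. ring.
- set (b := fun k => (RtoC (pochhammer (INR k + 1 - INR p) m / pochhammer (INR k + 1) m) * a k)%C).
  assert (Hb : forall w, in_disk w -> is_series (fun k => (b k * w ^ k)%C) (I m w)).
  { apply IH. lia. }
  destruct (HI (S m) ltac:(lia) z Hz) as [q [Hq ->]].
  replace (S m - 1)%nat with m in * by lia.
  set (F := integral_from_0 (fun w => (w ^ m * I m w)%C)) in *.
  set (b' := fun k => (RtoC (/ (INR k + INR (S m))) * b k)%C).
  (* Through [CSeries] the quotient becomes one function of [w], whereas the integral lemma yields a
     sum at each point separately. *)
  set (G := fun w => CSeries (fun k => (b' k * w ^ k)%C)).
  assert (HG : forall w, in_disk w ->
    is_series (fun k => (b' k * w ^ k)%C) (G w) /\ F w = (w ^ S m * G w)%C).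
  { intros w Hw.
    destruct (integral_monomial_power_series b (I m) m w Hb Hw) as [s [Hs HF]].
    replace (G w) with s; [now split|]. symmetry. exact (is_series_CSeries _ s Hs). }
  rewrite (quotient_value_unique F G b' (S m) z q (fun w Hw => proj1 (HG w Hw))
    (fun w Hw => proj2 (HG w Hw)) Hz Hq).
  eapply is_series_ext;
    [|apply (is_series_minus (V := C_NormedModule)); [apply (Hb z Hz)|apply (is_series_scal (V := C_NormedModule) (RtoC (INR p)));
      apply (HG z Hz)]].
  intros k. unfold b', b. change plus with Cplus. change opp with Copp. change scal with Cmult. eq_in_C.
  pose proof (pos_INR k). pose proof (pos_INR m).
  pose proof (pochhammer_pos (INR k + 1) m ltac:(lra)).
  simpl pochhammer. rewrite S_INR.
  (* The new factor is [1 - p/(k+m+1) = (k+1-p+m)/(k+1+m)], the ratio of the next factors of the two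
     Pochhammer symbols. *)
  transitivity (RtoC (pochhammer (INR k + 1 - INR p) m / pochhammer (INR k + 1) m
    - INR p * (/ (INR k + (INR m + 1))
    * (pochhammer (INR k + 1 - INR p) m / pochhammer (INR k + 1) m))) * a k * z ^ k)%C.
  + rewrite RtoC_minus, !RtoC_mult. ring.
  + do 3 f_equal. field. lra.
Qed.

(** Stated for an arbitrary power series so that it serves both [h] and [g]. As [-alpha/2 = 1-p] and
    [k-alpha/2 = k+1-p], the weighted sum over [n] rebuilds the terminating hypergeometric sum in
    each coefficient. *)
Lemma real_kernel_power_series (p : nat) (alpha : R) (I : nat -> C -> C) (a : nat -> C) (z : C) :
  (1 <= p)%nat -> alpha / 2 = INR p - 1 ->
  recurrence p I ->
  (forall w, in_disk w -> is_series (fun k => (a k * w ^ k)%C) (I 0%nat w)) ->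
  in_disk z ->
  is_series (fun k =>
    (a k * RtoC (hyp2F1 (- (alpha / 2)) (INR k - alpha / 2) (INR k + 1) (Cmod z ^ 2)) * z ^ k)%C)
   (sum_n (fun n =>
      (RtoC (Cmod z ^ (2 * n) * (pochhammer (1 - INR p) n / INR (fact n))) * I n z)%C) (p - 1)).
Proof.
intros Hp Halpha HI H0 Hz.
assert (E1 : - (alpha / 2) = - INR (p - 1)) by (rewrite minus_INR, Halpha by lia; simpl; ring).
assert (E2 : 1 - INR p = - INR (p - 1)) by (rewrite minus_INR by lia; simpl; ring).
eapply is_series_ext; [|apply is_series_sum_n; intros n Hn;
  apply (is_series_scal (V := C_NormedModule) (RtoC (Cmod z ^ (2 * n) * (pochhammer (1 - INR p) n / INR (fact n)))));
  exact (recurrence_power_series p I a HI H0 n Hn z Hz)].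
intros k. cbv beta. rewrite E1, E2, hyp2F1_neg_nat.
replace (INR k - alpha / 2) with (INR k + 1 - INR p) by lra.
pose proof (pos_INR k) as Hk.
(* The Pochhammer parameter and the summation bound are generalized separately, so that the
   induction varies the bound alone. *)
generalize (- INR (p - 1)). intros x. generalize (p - 1)%nat. intros m.
assert (Hterm : forall n,
  (RtoC (Cmod z ^ (2 * n) * (pochhammer x n / INR (fact n)))
   * (RtoC (pochhammer (INR k + 1 - INR p) n / pochhammer (INR k + 1) n) * a k * z ^ k))%C
  = (a k * RtoC (pochhammer x n * pochhammer (INR k + 1 - INR p) n / pochhammer (INR k + 1) n
       / INR (fact n) * (Cmod z ^ 2) ^ n) * z ^ k)%C).
{ intros n. rewrite <- pow_mult.
  transitivity (a k * RtoC ((Cmod z ^ (2 * n) * (pochhammer x n / INR (fact n)))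
    * (pochhammer (INR k + 1 - INR p) n / pochhammer (INR k + 1) n)) * z ^ k)%C.
  - rewrite !RtoC_mult. ring.
  - do 3 f_equal. field. split; [|apply INR_fact_neq_0].
    apply Rgt_not_eq, pochhammer_pos. lra. }
induction m as [|m IH].
- rewrite !sum_O. apply Hterm.
- rewrite !sum_Sn, IH. change scal with Cmult. rewrite Hterm.
  change plus with Cplus at 1. change plus with Rplus. rewrite RtoC_plus. eq_in_C. ring.
Qed.

(** * Joining the analytic and the conjugate-analytic halves *)

Theorem theorem2p1
  (alpha : R) (p : nat) (c : Z -> C) (v h g u : C -> C) (I J : nat -> C -> C)
  (Halpha : -1 < alpha)
  (Hp : (1 <= p)%nat)
  (Halphap : alpha / 2 = INR p - 1)
  (Hv : harmonic_mapping v)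
  (Hvhg : forall z : C, in_disk z -> v z = (h z + Cconj (g z))%C)
  (Hh : forall z : C, in_disk z ->
     is_series (fun k : nat => (c (Z.of_nat k) * z ^ k)%C) (h z))
  (Hg : forall z : C, in_disk z ->
     is_series (fun j : nat => (Cconj (c (- Z.of_nat (S j))%Z) * z ^ S j)%C) (g z))
  (Hu : forall z : C, in_disk z -> u z = real_kernel_harmonic alpha c z)
  (HI0 : forall z : C, in_disk z -> I 0%nat z = h z)
  (HI : recurrence p I)
  (HJ0 : forall z : C, in_disk z -> J 0%nat z = g z)
  (HJ : recurrence p J) :
  forall z : C, in_disk z ->
    u z = sum_n (fun n : nat =>
            (RtoC (Cmod z ^ (2 * n) * (pochhammer (1 - INR p) n / INR (fact n)))%R
             * (I n z + Cconj (J n z)))%C) (p - 1).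
Proof.
intros z Hz. rewrite (Hu z Hz).
assert (SI : forall w, in_disk w -> is_series (fun k => (c (Z.of_nat k) * w ^ k)%C) (I 0%nat w)).
{ intros w Hw. rewrite HI0 by exact Hw. now apply Hh. }
(* The series of [g] has no constant term; [d] supplies a zero at index 0 so that it fits the form
   indexed from 0. *)
set (d := fun k => match k with
  | O => RtoC 0 | S _ => Cconj (c (- Z.of_nat k)%Z) end).
assert (SJ : forall w, in_disk w -> is_series (fun k => (d k * w ^ k)%C) (J 0%nat w)).
{ intros w Hw. rewrite HJ0 by exact Hw. apply is_series_decr_1.
  replace (plus (g w) _) with (g w); [now apply Hg|].
  change (g w = g w + - (RtoC 0 * 1))%C. ring. }
pose proof (real_kernel_power_series p alpha I _ z Hp Halphap HI SI Hz) as KI.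
pose proof (real_kernel_power_series p alpha J d z Hp Halphap HJ SJ Hz) as KJ.
(* The weights and hypergeometric factors are real, so conjugation affects only the coefficients,
   the powers of [z] and the [J n]. *)
apply is_series_conj in KJ.
unfold real_kernel_harmonic.
rewrite (is_series_CSeries _ _ KI).
apply is_series_drop_zero in KJ; [|cbv beta; rewrite !Cmult_conj; simpl d;
  apply injective_projections; simpl; ring].
assert (Cconj_R : forall x : R, Cconj (RtoC x) = RtoC x).
{ intros x. apply injective_projections; simpl; ring. }
eapply eq_trans.
{ apply f_equal, is_series_CSeries. eapply is_series_ext; [|exact KJ].
  intros j. unfold d. cbv beta zeta.
  now rewrite !Cmult_conj, Cconj_conj, Cpow_conj, Cconj_R. }
(* Only the additivity of finite sums and of conjugation remains. *)
generalize (p - 1)%nat. intros m. induction m as [|m IH].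
- rewrite !sum_O, Cmult_conj, Cconj_R. eq_in_C. ring.
- rewrite !sum_Sn, <- IH. change plus with Cplus. rewrite Cplus_conj, Cmult_conj, Cconj_R.
  eq_in_C. ring.
Qed.
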